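(* Let $a_0,a_1,b_0,b_1,b_2$ be analytic functions of $(t_1,t_2)$ on a domain in $\mathbb{C}^2$, put $c_0=b_2^2-b_2t_1+\frac14t_1^2-b_1+t_2$ and $c_1=-b_2+t_1$, and let $$A=\begin{pmatrix}0&1\\0&0\end{pmatrix}z^3+\begin{pmatrix}0&b_2\\1&0\end{pmatrix}z^2+\begin{pmatrix}a_1&b_1\\c_1&-a_1\end{pmatrix}z+\begin{pmatrix}a_0&b_0\\c_0&-a_0\end{pmatrix}.$$ Suppose that for $i=1,2$ there is a trace-zero $2\times2$ matrix $B_i$, polynomial in $z$ of degree $\le2$ with coefficients depending on $(t_1,t_2)$, such that $\big[z\frac{d}{dz}+A,\frac{d}{dt_i}+B_i\big]=0$. Then $$\begin{aligned} d(a_0)={}&\big\{16b_2^4-16b_2^3t_1+4b_2t_1^3-t_1^4-48b_1b_2^2+32b_1b_2t_1-4b_1t_1^2+32b_2^2t_2-16b_2t_1t_2\\&\ -16b_0b_2+8b_0t_1+32b_1^2-48b_1t_2+16t_2^2\big\}\tfrac{dt_1}{48}\\&+\big\{3b_2^2t_1-2b_2^3-\tfrac{3b_2t_1^2}{2}+\tfrac{t_1^3}{4}+2b_1b_2-b_1t_1-2b_2t_2+t_1t_2+b_0\big\}dt_2,\\ d(a_1)={}&\big\{-16b_2^3+20b_2^2t_1-4b_2t_1^2-t_1^3+16b_1b_2-16b_1t_1-16b_2t_2+12t_1t_2+8b_0\big\}\tfrac{dt_1}{24}\\&+\big\{b_2^2-2b_2t_1+\tfrac34t_1^2+2b_1-t_2\big\}dt_2,\\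 d(b_0)={}&\big\{a_0t_1^2-4a_0b_2^2+8a_0b_1-4a_0t_2-4a_1b_0\big\}\tfrac{dt_1}{6}+(4b_2-2t_1)a_0\,dt_2,\\ d(b_1)={}&\big\{-4a_1b_2^2+a_1t_1^2+4a_0b_2-2a_0t_1+4a_1b_1-4a_1t_2+2b_2-t_1\big\}\tfrac{dt_1}{6}\\&+\big\{4a_1b_2-2a_1t_1+2a_0+1\big\}dt_2,\\ d(b_2)={}&\big\{-a_1t_1+2a_0+2\big\}\tfrac{dt_1}{3}+2a_1\,dt_2, \end{aligned}$$ and $p_0:=a_0^2+b_0c_0$ satisfies $d(p_0)=0$.
   Context: Here $d$ applied to a function $g$ of $(t_1,t_2)$ is the total differential $dg=\frac{\partial g}{\partial t_1}dt_1+\frac{\partial g}{\partial t_2}dt_2$. The family consists of rank 2 connections with $z=0$ regular singular and generalized eigenvalues $\pm(z^{5/2}+\frac{t_1}2z^{3/2}+\frac{t_2}2z^{1/2})$ at $z=\infty$. The condition $[z\frac{d}{dz}+A,\frac{d}{dt_i}+B_i]=0$ means $\frac{\partial A}{\partial t_i}=z\frac{\partial B_i}{\partial z}+[A,B_i]$ identically in $z$. *)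

(* Defs.v *)
From HB Require Import structures.
From mathcomp Require Import all_boot all_order all_algebra complex.
From mathcomp Require Import all_classical all_reals all_analysis.

Set Implicit Arguments.
Unset Strict Implicit.
Unset Printing Implicit Defensive.

Import Order.TTheory GRing.Theory Num.Theory.
Import numFieldNormedType.Exports.

Local Open Scope classical_set_scope.
Local Open Scope ring_scope.

(* The complex numbers over R.  Naming the numClosedFieldType itself (rather
   than its carrier R[i]) is what makes the canonical topology and norm of
   numeric fields available on it. *)
Definition CC (R : realType) : numClosedFieldType := complex R.

Section Defs.
Context {R : realType}.
Local Notation C := (CC R).
Implicit Types (U : set (C * C)) (g : C * C -> C) (t : C * C) (z : C).

Definition domain U := [/\ U !=set0, open U & connected U].

(* On some polydisc around t, g is the sum of an absolutely convergent power
   series in the two displacements.  The radius r and the bound M have type C,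
   but 0 < r and _ <= M force them to be real. *)
Definition analytic_at g t :=
  exists (c : nat -> nat -> C) (r : C), 0 < r /\
    forall h : C * C, `|h.1| < r -> `|h.2| < r ->
      (exists M : C, forall n : nat,
         \sum_(i < n) \sum_(j < n) `|c i j * h.1 ^+ i * h.2 ^+ j| <= M) /\
      (fun n : nat => \sum_(i < n) \sum_(j < n) c i j * h.1 ^+ i * h.2 ^+ j)
        @ \oo --> g (t + h).

Definition analytic_on U g := forall t, U t -> analytic_at g t.

(* The index 0 stands for t_1 and the index 1 for t_2. *)
Definition basis (i : 'I_2) : C * C := if i == ord0 then (1, 0) else (0, 1).

Definition partial (i : 'I_2) g t : C := 'D_(basis i) g t.

(* The 1-form dg at t, evaluated on the tangent vector dt; the coordinate
   forms dt_1 and dt_2 are the two projections of dt. *)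
Definition total_d g t (dt : C * C) : C :=
  partial ord0 g t * dt.1 + partial ord_max g t * dt.2.

Definition mx22 (T : Type) (x y u v : T) : 'M[T]_2 :=
  \matrix_(i, j) if i == ord0 then (if j == ord0 then x else y)
                 else (if j == ord0 then u else v).

Definition mx_eval z (M : 'M[{poly C}]_2) : 'M[C]_2 :=
  map_mx (fun p : {poly C} => p.[z]) M.

Definition mx_partial (i : 'I_2) (A : C * C -> 'M[{poly C}]_2) t z : 'M[C]_2 :=
  \matrix_(j, k) partial i (fun s => (A s j k).[z]) t.

(* [z d/dz + A, d/dt_i + B] = 0 on U, identically in z. *)
Definition zero_curvature U (i : 'I_2) (A B : C * C -> 'M[{poly C}]_2) :=
  forall t, U t -> forall z,
    mx_partial i A t z =
    mx_eval z ('X *: map_mx (fun p : {poly C} => p^`()) (B t)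
               + (A t *m B t - B t *m A t)).

End Defs.

(* Main.v *)
Require Import Defs.
From HB Require Import structures.
From mathcomp Require Import all_boot all_order all_algebra complex.
From mathcomp Require Import all_classical all_reals all_analysis.
From mathcomp Require Import ring.

(** Write [B] as [[al, be; ga, -al]] with quadratic entries.  Comparing powers
    of [z] in the zero-curvature equation, the top powers force [al] to be the
    constant [a1 * ga_1] and give [be_2], [ga_0], [be_0] from [ga_1] and [be_1].
    The two remaining unknowns come from differentiating the normalizations:
    [c1 + b2 = t1] gives [3 * ga_1 = dt1], and the formula for [c0] gives
    [be_1 = dt2 + (2 * b2 - t1) * dt1 / 6].  The low powers of [z] are then the
    asserted equations.  At [z = 0] the equation reads [dA(0) = [A(0), B(0)]],
    so [det A(0) = - p0] is constant. *)

Set Implicit Arguments.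
Unset Strict Implicit.
Unset Printing Implicit Defensive.

Import Order.TTheory GRing.Theory Num.Theory.
Import numFieldNormedType.Exports.

Local Open Scope classical_set_scope.
Local Open Scope ring_scope.

(** * Polynomial identities: from values to coefficients *)

Lemma poly_eq0_horner (F : numDomainType) (p : {poly F}) :
  (forall z, p.[z] = 0) -> p = 0.
Proof.
move=> p0; apply/eqP; apply: contraT => pn0.
(* The numbers [0, ..., size p - 1] are distinct in characteristic 0, so a nonzero [p] vanishing at
   all of them would have more roots than its degree. *)
have := @max_poly_roots F p [seq i%:R | i <- iota 0 (size p)] pn0.
rewrite size_map size_iota ltnn; apply.
  by apply/allP => z _; apply/rootP.
by rewrite map_inj_uniq ?iota_uniq // => i j /eqP; rewrite eqr_nat => /eqP.
Qed.

(** Degree 5 covers every entry of the zero-curvature equation: the entries of [A] have degree at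
    most 3 in [z] and those of [B] at most 2. *)
Lemma quintic_eq0 (F : numDomainType) (e0 e1 e2 e3 e4 e5 : F) :
  (forall z, e0 + e1 * z + e2 * z ^+ 2 + e3 * z ^+ 3 + e4 * z ^+ 4
             + e5 * z ^+ 5 = 0) ->
  [/\ e0 = 0, e1 = 0 & e2 = 0] /\ [/\ e3 = 0, e4 = 0 & e5 = 0].
Proof.
move=> e_z; pose p := Poly [:: e0; e1; e2; e3; e4; e5].
have p0 : p = 0.
  by apply: poly_eq0_horner => z; rewrite horner_Poly -[RHS](e_z z) /=; ring.
have pE i : [:: e0; e1; e2; e3; e4; e5]`_i = 0.
  by rewrite -coef_Poly -/p p0 coef0.
by split; split; [exact: (pE 0%N) | exact: (pE 1%N) | exact: (pE 2%N)
  | exact: (pE 3%N) | exact: (pE 4%N) | exact: (pE 5%N)].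
Qed.

Lemma horner_size3 (F : comNzRingType) (p : {poly F}) z : (size p <= 3)%N ->
  p.[z] = p`_0 + p`_1 * z + p`_2 * z ^+ 2.
Proof.
move=> p3; rewrite (horner_coef_wide _ p3) !big_ord_recl big_ord0 /=.
by rewrite /bump /=; ring.
Qed.

Lemma horner_deriv_size3 (F : comNzRingType) (p : {poly F}) z :
  (size p <= 3)%N -> p^`().[z] = p`_1 + p`_2 * z *+ 2.
Proof.
move=> p3.
have p'2 : (size p^`() <= 2)%N.
  by rewrite (leq_trans (size_poly _ _)) // -subn1 leq_subLR.
rewrite (horner_coef_wide _ p'2) !big_ord_recl big_ord0 /= /bump /=.
by rewrite !coef_deriv; ring.
Qed.

(** Solves a coefficient equation [e = 0] for one unknown [x]: [k] is the inverse of the coefficient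
    of [x] in [e], and what remains is an identity for [ring] or [field]. *)
Lemma eq_by_multiple (F : pzRingType) (k e x y : F) :
  e = 0 -> x - y = k * e -> x = y.
Proof. by move=> ->; rewrite mulr0 => /subr0_eq. Qed.

(** * Elimination of the coefficients of [B] in a fixed direction *)

Section IsomonodromyEquations.
Variables (F : numFieldType).
Variables (t1 t2 e1 e2 a0 a1 b0 b1 b2 : F) (al be ga : nat -> F).
Variables (da0 da1 db0 db1 db2 : F).
Let c0 := b2 ^+ 2 - b2 * t1 + 1 / 4 * t1 ^+ 2 - b1 + t2.
Let c1 := - b2 + t1.
(** These are the derivatives of [c0] and [c1] by the product rule, where [e1] and [e2] are the
    derivatives of [t1] and [t2] in the chosen direction. *)
Let dc0 := 2 * b2 * db2 - db2 * t1 - b2 * e1 + 1 / 2 * t1 * e1 - db1 + e2.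
Let dc1 := - db2 + e1.
Let p z := a1 * z + a0.
Let q z := z ^+ 3 + b2 * z ^+ 2 + b1 * z + b0.
Let r z := z ^+ 2 + c1 * z + c0.
Let quad (f : nat -> F) z := f 0%N + f 1%N * z + f 2 * z ^+ 2.
Let dquad (f : nat -> F) z := f 1%N + f 2 * z *+ 2.

Hypothesis eq11 : forall z,
  da1 * z + da0 = z * dquad al z + (q z * quad ga z - quad be z * r z).
Hypothesis eq12 : forall z,
  db2 * z ^+ 2 + db1 * z + db0 =
  z * dquad be z + 2 * (p z * quad be z - q z * quad al z).
Hypothesis eq21 : forall z,
  dc1 * z + dc0 = z * dquad ga z + 2 * (r z * quad al z - p z * quad ga z).

(** Differentiation enters only through the symbols [da0, ..., db2], [dc0], [dc1], so the statement
    is pure algebra over a field. The sequences [al], [be], [ga] list the coefficients of the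
    entries of [B], and [eq11], [eq12], [eq21] are the matrix entries named by their indices. *)
Lemma isomonodromy_equations :
  [/\ da0 =
        (16 * b2 ^+ 4 - 16 * b2 ^+ 3 * t1 + 4 * b2 * t1 ^+ 3 - t1 ^+ 4
         - 48 * b1 * b2 ^+ 2 + 32 * b1 * b2 * t1 - 4 * b1 * t1 ^+ 2
         + 32 * b2 ^+ 2 * t2 - 16 * b2 * t1 * t2
         - 16 * b0 * b2 + 8 * b0 * t1 + 32 * b1 ^+ 2
         - 48 * b1 * t2 + 16 * t2 ^+ 2) * (e1 / 48)
        + (3 * b2 ^+ 2 * t1 - 2 * b2 ^+ 3 - 3 * b2 * t1 ^+ 2 / 2
           + t1 ^+ 3 / 4 + 2 * b1 * b2 - b1 * t1 - 2 * b2 * t2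
           + t1 * t2 + b0) * e2,
      da1 =
        (- (16 * b2 ^+ 3) + 20 * b2 ^+ 2 * t1 - 4 * b2 * t1 ^+ 2
         - t1 ^+ 3 + 16 * b1 * b2 - 16 * b1 * t1 - 16 * b2 * t2
         + 12 * t1 * t2 + 8 * b0) * (e1 / 24)
        + (b2 ^+ 2 - 2 * b2 * t1 + 3 / 4 * t1 ^+ 2 + 2 * b1 - t2) * e2,
      db0 =
        (a0 * t1 ^+ 2 - 4 * a0 * b2 ^+ 2 + 8 * a0 * b1
         - 4 * a0 * t2 - 4 * a1 * b0) * (e1 / 6)
        + (4 * b2 - 2 * t1) * a0 * e2,
      db1 =
        (- (4 * a1 * b2 ^+ 2) + a1 * t1 ^+ 2 + 4 * a0 * b2
         - 2 * a0 * t1 + 4 * a1 * b1 - 4 * a1 * t2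
         + 2 * b2 - t1) * (e1 / 6)
        + (4 * a1 * b2 - 2 * a1 * t1 + 2 * a0 + 1) * e2 &
      db2 = (- (a1 * t1) + 2 * a0 + 2) * (e1 / 3) + 2 * a1 * e2]
  /\ 2 * a0 * da0 + db0 * c0 + b0 * dc0 = 0.
Proof.
(* In each of the three blocks the equations are the coefficients of
   [z ^ 0, ..., z ^ 5] in this order. *)
have [[h0 h1 h2] [h3 h4 h5]] : [/\
    ga 0%N * b0 - be 0%N * c0 - da0 = 0,
    al 1%N + b1 * ga 0%N + b0 * ga 1%N - c1 * be 0%N - c0 * be 1%N - da1 = 0 &
    2 * al 2 + b2 * ga 0%N + b1 * ga 1%N + b0 * ga 2 - be 0%N - c1 * be 1%N
      - c0 * be 2 = 0] /\ [/\
    ga 0%N + b2 * ga 1%N + b1 * ga 2 - be 1%N - c1 * be 2 = 0,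
    ga 1%N + b2 * ga 2 - be 2 = 0 & ga 2 = 0].
  (* Zero is written as the left side of [eq11] minus itself, and only the first copy is expanded;
     this exhibits the equation as a vanishing quintic. The next two blocks do the same. *)
  apply: quintic_eq0 => z; rewrite -[RHS](subrr (da1 * z + da0)) {1}eq11.
  by rewrite /quad /dquad /q /r; ring.
have [[k0 k1 k2] [k3 k4 k5]] : [/\
    2 * a0 * be 0%N - 2 * b0 * al 0%N - db0 = 0,
    be 1%N + 2 * a1 * be 0%N + 2 * a0 * be 1%N
      - 2 * (b1 * al 0%N + b0 * al 1%N) - db1 = 0 &
    2 * be 2 + 2 * a1 * be 1%N + 2 * a0 * be 2
      - 2 * (b2 * al 0%N + b1 * al 1%N + b0 * al 2) - db2 = 0] /\ [/\
    2 * a1 * be 2 - 2 * (al 0%N + b2 * al 1%N + b1 * al 2) = 0,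
    - 2 * (al 1%N + b2 * al 2) = 0 & - 2 * al 2 = 0].
  apply: quintic_eq0 => z.
  rewrite -[RHS](subrr (db2 * z ^+ 2 + db1 * z + db0)) {1}eq12.
  by rewrite /quad /dquad /p /q; ring.
have [[l0 l1 _] _] : [/\
    2 * c0 * al 0%N - 2 * a0 * ga 0%N - dc0 = 0,
    ga 1%N + 2 * (c1 * al 0%N + c0 * al 1%N) - 2 * a1 * ga 0%N
      - 2 * a0 * ga 1%N - dc1 = 0 &
    2 * ga 2 + 2 * (al 0%N + c1 * al 1%N + c0 * al 2)
      - 2 * (a1 * ga 1%N + a0 * ga 2) = 0] /\ [/\
    2 * (al 1%N + c1 * al 2) - 2 * a1 * ga 2 = 0, 2 * al 2 = 0 & 0 = 0 :> F].
  apply: quintic_eq0 => z; rewrite -[RHS](subrr (dc1 * z + dc0)) {1}eq21.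
  by rewrite /quad /dquad /p /r; ring.
(* The system is triangular: reading the powers of [z] from the top down, each coefficient equation
   determines one new unknown in terms of those already found. *)
have al2 : al 2 = 0 by apply: (eq_by_multiple (k := - 1 / 2) k5); field.
have al1 : al 1%N = 0.
  by apply: (eq_by_multiple (k := - 1 / 2) k4); rewrite al2; field.
have be2 : be 2 = ga 1%N.
  by apply: (eq_by_multiple (k := - 1) h4); rewrite h5; ring.
have al0 : al 0%N = a1 * ga 1%N.
  by apply: (eq_by_multiple (k := - 1 / 2) k3); rewrite al1 al2 be2; field.
have ga0 : ga 0%N = be 1%N + (t1 - 2 * b2) * ga 1%N.
  by apply: (eq_by_multiple (k := 1) h3); rewrite h5 be2 /c1; ring.
have be0 : be 0%N = b2 * ga 0%N + b1 * ga 1%N - c1 * be 1%N - c0 * ga 1%N.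
  by apply: (eq_by_multiple (k := - 1) h2); rewrite al2 h5 be2; ring.
have db2E : db2 = 2 * ga 1%N + 2 * a1 * be 1%N + 2 * a0 * ga 1%N
                  - 2 * b2 * al 0%N.
  by apply: (eq_by_multiple (k := - 1) k2); rewrite al1 al2 be2; ring.
have db1E : db1 = be 1%N + 2 * a1 * be 0%N + 2 * a0 * be 1%N - 2 * b1 * al 0%N.
  by apply: (eq_by_multiple (k := - 1) k1); rewrite al1; ring.
(* Once [db2] is substituted into [dc1], all terms containing [a0] or [a1] cancel. The factor 3
   collects contributions of the term [z * B']: one [ga 1] from the entry (2,1), and
   [2 * be 2 = 2 * ga 1] from the entry (1,2). *)
have ga1 : ga 1%N = e1 / 3.
  apply: (eq_by_multiple (k := 1 / 3) l1).
  by rewrite /dc1 db2E al1 ga0 al0 /c1; field.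
(* The terms in [a0] and [a1] cancel again, leaving [be 1 - e2 = (2/3 - 1/2) * (2 * b2 - t1) * e1]:
   the [2/3] comes from [db2], the [1/2] from differentiating [t1] inside [c0]. *)
have be1 : be 1%N = e2 + e1 * (2 * b2 - t1) / 6.
  apply: (eq_by_multiple (k := 1) l0).
  by rewrite /dc0 db2E db1E be0 ga0 al0 ga1 /c0 /c1; field.
have {}db2E : db2 = (- (a1 * t1) + 2 * a0 + 2) * (e1 / 3) + 2 * a1 * e2.
  by rewrite db2E al0 be1 ga1; field.
have da0E : da0 = ga 0%N * b0 - be 0%N * c0 by rewrite (subr0_eq h0).
have db0E : db0 = 2 * a0 * be 0%N - 2 * b0 * al 0%N by rewrite (subr0_eq k0).
have dc0E : dc0 = 2 * c0 * al 0%N - 2 * a0 * ga 0%N by rewrite (subr0_eq l0).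
(* The derivative of [p0] vanishes identically in [al 0], [be 0], [ga 0]: a commutator with [A(0)]
   does not change the determinant of [A(0)] to first order. *)
split; last by rewrite da0E db0E dc0E; ring.
split=> //.
- by rewrite da0E be0 ga0 ga1 be1 /c0 /c1; field.
- by rewrite -(subr0_eq h1) al1 be0 ga0 ga1 be1 /c0 /c1; field.
- by rewrite db0E be0 ga0 al0 ga1 be1 /c0 /c1; field.
- by rewrite db1E be0 ga0 al0 ga1 be1 /c0 /c1; field.
Qed.

End IsomonodromyEquations.

(** * Partial derivatives of analytic functions *)

Lemma cvg_diff_quotient (F : numFieldType) (f : F -> F) (d K rho : F) :
  0 < rho ->
  (forall h, `|h| < rho -> `|f h - f 0 - d * h| <= K * `|h| ^+ 2) ->
  (fun h => h^-1 * (f h - f 0)) @ 0^' --> d.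
Proof.
move=> rho0 fK; apply/cvgrPdist_lt => e e0.
(* The bound at the single nonzero point [rho / 2] already forces [K] to be nonnegative. *)
have K0 : 0 <= K.
  have rho2 : `|rho / 2| = rho / 2 by rewrite ger0_norm // divr_ge0 // ltW.
  have := fK (rho / 2); rewrite rho2 ltr_pdivrMr // ltr_pMr // ltr1n.
  move=> /(_ isT) /(le_trans (normr_ge0 _)); rewrite pmulr_lge0 //.
  by rewrite exprn_gt0 // divr_gt0.
(* The quotient differs from [d] by at most [K * |h|], so [|h| < e / (K + 1)] suffices; adding 1
   keeps the denominator positive when [K = 0]. *)
have K1 : 0 < K + 1 by rewrite ltr_wpDl.
near=> h.
have h0 : h != 0 by near: h; exact: nbhs_dnbhs_neq.
have -> : d - h^-1 * (f h - f 0) = - (h^-1 * (f h - f 0 - d * h)) by field.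
rewrite normrN normrM normfV ltr_pdivrMl ?normr_gt0 //.
have hrho : `|h| < rho.
  by near: h; apply: dnbhs0_lt.
have he : `|h| < e / (K + 1).
  by near: h; apply: dnbhs0_lt; rewrite divr_gt0.
apply: le_lt_trans (fK _ hrho) _.
rewrite expr2 mulrCA ltr_pM2l ?normr_gt0 //.
move: he; rewrite ltr_pdivlMr // => /(le_lt_trans _); apply.
by rewrite mulrC ler_wpM2l // lerDl.
Unshelve. all: by end_near. Qed.

(** With [rho = r / 2] and [|h| < rho], each term of index at least 2 is at most [(|h| / rho) ^ 2]
    times the corresponding term at [rho]. The absolute partial sums at [rho] are bounded by [M],
    whence [K = M / rho ^ 2]. *)
Lemma power_series_quadratic_remainder (F : numFieldType) (c : nat -> F)
    (f : F -> F) (r : F) : 0 < r ->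
  (forall h, `|h| < r ->
    (exists M, forall n, \sum_(i < n) `|c i * h ^+ i| <= M) /\
    (fun n => \sum_(i < n) c i * h ^+ i) @ \oo --> f h) ->
  exists K, forall h, `|h| < r / 2 ->
    `|f h - f 0 - c 1%N * h| <= K * `|h| ^+ 2.
Proof.
move=> r0 cf; pose rho := r / 2.
have rho0 : 0 < rho by rewrite divr_gt0.
have [[M cM] _] : (exists M, forall n, \sum_(i < n) `|c i * rho ^+ i| <= M) /\
    (fun n => \sum_(i < n) c i * rho ^+ i) @ \oo --> f rho.
  by apply: cf; rewrite gtr0_norm // ltr_pdivrMr // ltr_pMr // ltr1n.
have f0 : f 0 = c 0%N.
  have [_ /cvg_lim <- //] := cf 0 ltac:(by rewrite normr0).
  apply: cvg_lim => //; apply: cvg_near_cst; near=> n.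
  have n0 : (0 < n)%N by near: n; exact: nbhs_infty_gt.
  rewrite -(prednK n0) big_ord_recl expr0 mulr1 big1 ?addr0 // => i _.
  by rewrite exprS mul0r mulr0.
exists (M / rho ^+ 2) => h hrho.
have hr : `|h| < r.
  by apply: lt_trans hrho _; rewrite ltr_pdivrMr // ltr_pMr // ltr1n.
(* Up to an arbitrary error [e], the value [f h] is replaced by a partial sum, taken of length
   [N.+2] so that the constant and linear terms can be split off. *)
apply/ler_addgt0Pr => e e0.
have [_ /cvgrPdist_lt/(_ e e0)[N _ fN]] := cf h hr.
pose n := N.+2; have {fN} := fN n ltac:(exact: leq_trans (leqnSn N) (leqnSn _)).
rewrite f0 /n /= 2!big_ord_recl /= /bump /= expr0 expr1 mulr1.
set S := \sum_(i < N) _ => fS.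
have -> : f h - c 0%N - c 1%N * h = S + (f h - (c 0%N + (c 1%N * h + S))).
  by ring.
apply: le_trans (ler_normD _ _) _; apply: lerD; last exact: ltW.
apply: le_trans (ler_norm_sum _ _ _) _.
have := cM N.+2; rewrite 2!big_ord_recl /= => cMN.
have {}cMN : \sum_(i < N) `|c i.+2 * rho ^+ i.+2| <= M.
  by apply: le_trans cMN; rewrite addrA lerDr addr_ge0.
rewrite mulrAC ler_pdivlMr ?exprn_gt0 // mulr_suml.
apply: le_trans (ler_wpM2r (exprn_ge0 2 (normr_ge0 h)) cMN).
rewrite mulr_suml; apply: ler_sum => i _; rewrite /bump /= !add1n.
have nX k x : `|c k * x ^+ k| = `|c k| * `|x| ^+ k by rewrite normrM normrX.
have pw (k : nat) : `|h| ^+ (k + 2) * rho ^+ 2 <= rho ^+ (k + 2) * `|h| ^+ 2.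
  rewrite !exprD mulrAC ler_wpM2r ?exprn_ge0 //.
  rewrite ler_wpM2r ?exprn_ge0 ?(ltW rho0) //.
  by rewrite lerXn2r ?nnegrE ?(ltW rho0) // ltW.
rewrite -addn2 !nX (gtr0_norm rho0) -[leLHS]mulrA -[leRHS]mulrA.
exact: ler_wpM2l.
Unshelve. all: by end_near. Qed.

Section Partial.
Context {R : realType}.
Local Notation C := (CC R).
Implicit Types (g : C * C -> C) (t : C * C).

(** Along a coordinate line the other displacement is 0, so the double series reduces to the single
    series with coefficients [d]; its quadratic remainder shows that the derivative is [d 1]. *)
Lemma analytic_derivable g t (i : 'I_2) :
  analytic_at g t -> derivable g t (Defs.basis i).
Proof.
move=> [c [r [r0 cg]]].
pose d n := if i == ord0 then c n 0%N else c 0%N n.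
pose f (h : C) := g (t + h *: Defs.basis i).
(* The function [phi] is the norm for the bound on absolute partial sums and the identity for their
   convergence. *)
have df (phi : C -> C) h n : phi 0 = 0 -> \sum_(k < n) \sum_(l < n)
    phi (c k l * (h *: @Defs.basis R i).1 ^+ k * (h *: @Defs.basis R i).2 ^+ l)
    = \sum_(k < n) phi (d k * h ^+ k).
  move=> phi0; case: n => [|n]; first by rewrite !big_ord0.
  rewrite /d /Defs.basis; case: ifP => _ /=.
    apply: eq_bigr => k _; rewrite big_ord_recl big1 ?addr0 => [|l _] /=.
      by rewrite /GRing.scale /= expr0 !mulr1.
    by rewrite /GRing.scale /= mulr0 exprS mul0r mulr0.
  rewrite big_ord_recl [X in _ + X]big1 ?addr0 => [|k _] /=.
    by apply: eq_bigr => l _; rewrite /GRing.scale /= expr0 !mulr1.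
  rewrite big1 // => l _.
  by rewrite /GRing.scale /= mulr0 exprS mul0r mulr0 mul0r.
have df_cvg h : `|h| < r ->
    (exists M, forall n, \sum_(k < n) `|d k * h ^+ k| <= M) /\
    (fun n => \sum_(k < n) d k * h ^+ k) @ \oo --> f h.
  move=> hr; have [h1 h2] : `|(h *: @Defs.basis R i).1| < r /\
      `|(h *: @Defs.basis R i).2| < r.
    by rewrite /Defs.basis; case: ifP => _ /=;
      rewrite /GRing.scale /= mulr1 mulr0 normr0.
  have [[M cM] cvg_g] := cg _ h1 h2; split.
    by exists M => n; rewrite -(df (fun x => `|x|)) ?normr0.
  by under eq_fun do rewrite -(df id _ _ erefl).
have [K fK] := power_series_quadratic_remainder r0 df_cvg.
apply/cvg_ex; exists (d 1%N).
have := cvg_diff_quotient (divr_gt0 r0 (ltr0Sn _ 1)) fK.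
rewrite /f scale0r addr0.
by under eq_fun do rewrite [t + _]addrC.
Qed.

Lemma analytic_is_derive g t i :
  analytic_at g t -> is_derive t (Defs.basis i) g (partial i g t).
Proof. by move=> gt; apply: derivableP; exact: analytic_derivable. Qed.

Lemma is_derive_fst t v : is_derive t v (fst : C * C -> C) v.1.
Proof.
have cv :
    (fun h : C => h^-1 *: ((fst \o shift t) (h *: v) - t.1)) @ 0^' --> v.1.
  apply: cvg_near_cst; near=> h.
  have h0 : h != 0 by near: h; exact: nbhs_dnbhs_neq.
  by rewrite /= addrK scalerA mulVf // scale1r.
split; first by apply/cvg_ex; exists v.1.
exact: cvg_lim cv.
Unshelve. all: by end_near. Qed.

Lemma is_derive_snd t v : is_derive t v (snd : C * C -> C) v.2.
Proof.
have cv :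
    (fun h : C => h^-1 *: ((snd \o shift t) (h *: v) - t.2)) @ 0^' --> v.2.
  apply: cvg_near_cst; near=> h.
  have h0 : h != 0 by near: h; exact: nbhs_dnbhs_neq.
  by rewrite /= addrK scalerA mulVf // scale1r.
split; first by apply/cvg_ex; exists v.2.
exact: cvg_lim cv.
Unshelve. all: by end_near. Qed.
End Partial.

(** * The matrix [A], its derivatives and the scalar zero-curvature equations *)

Lemma horner_curvature_entry (F : comNzRingType) (A B : 'M[{poly F}]_2) j k z :
  map_mx (fun p : {poly F} => p.[z])
    ('X *: map_mx (fun p : {poly F} => p^`()) B + (A *m B - B *m A)) j k =
  z * (B j k)^`().[z] + (((A j ord0).[z] * (B ord0 k).[z]
    + (A j ord_max).[z] * (B ord_max k).[z])
    - ((B j ord0).[z] * (A ord0 k).[z]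
    + (B j ord_max).[z] * (A ord_max k).[z])).
Proof.
have l0 : lift ord0 ord0 = ord_max :> 'I_2 by exact: val_inj.
rewrite !mxE !big_ord_recl !big_ord0 l0 !addr0.
by rewrite !(hornerD, hornerN, hornerM, hornerX).
Qed.

Section LaxMatrix.
Context {F : numFieldType} {V : normedModType F}.
Let hornersE := (@hornerD F, @hornerM F, @hornerXn F, @hornerX F, @hornerC F).
Variables (x1 x2 a0 a1 b0 b1 b2 : V -> F).

(** The functions [x1] and [x2] stand for the coordinates [t_1] and [t_2]; they are kept abstract
    because only their derivatives [e1] and [e2] enter the calculus. *)
Definition laxc0 (s : V) : F :=
  b2 s ^+ 2 - b2 s * x1 s + 1 / 4 * x1 s ^+ 2 - b1 s + x2 s.

Definition laxc1 (s : V) : F := - b2 s + x1 s.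

Definition laxA (s : V) : 'M[{poly F}]_2 :=
    'X ^+ 3 *: map_mx polyC (mx22 0 1 0 0)
  + 'X ^+ 2 *: map_mx polyC (mx22 0 (b2 s) 1 0)
  + 'X *: map_mx polyC (mx22 (a1 s) (b1 s) (laxc1 s) (- a1 s))
  + map_mx polyC (mx22 (a0 s) (b0 s) (laxc0 s) (- a0 s)).

Lemma laxA00 s z : (laxA s ord0 ord0).[z] = a1 s * z + a0 s.
Proof. by rewrite /laxA /mx22 !mxE /= !hornersE; ring. Qed.

Lemma laxA01 s z :
  (laxA s ord0 ord_max).[z] = z ^+ 3 + b2 s * z ^+ 2 + b1 s * z + b0 s.
Proof. by rewrite /laxA /mx22 !mxE /= !hornersE; ring. Qed.

Lemma laxA10 s z :
  (laxA s ord_max ord0).[z] = z ^+ 2 + laxc1 s * z + laxc0 s.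
Proof. by rewrite /laxA /mx22 !mxE /= !hornersE; ring. Qed.

Lemma laxA11 s z : (laxA s ord_max ord_max).[z] = - (a1 s * z + a0 s).
Proof. by rewrite /laxA /mx22 !mxE /= !hornersE; ring. Qed.

Variables (t v : V) (e1 e2 da0 da1 db0 db1 db2 : F).
Hypotheses (x1D : is_derive t v x1 e1) (x2D : is_derive t v x2 e2).
Hypotheses (a0D : is_derive t v a0 da0) (a1D : is_derive t v a1 da1).
Hypotheses (b0D : is_derive t v b0 db0) (b1D : is_derive t v b1 db1).
Hypothesis b2D : is_derive t v b2 db2.

Let dc0 := 2 * b2 t * db2 - db2 * x1 t - b2 t * e1 + 1 / 2 * x1 t * e1
           - db1 + e2.
Let dc1 := - db2 + e1.

Lemma is_derive_laxc0 : is_derive t v laxc0 dc0.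
Proof.
have bbD := is_deriveM b2D b2D; have bxD := is_deriveM b2D x1D.
have xxD := is_deriveZ (1 / 4) (is_deriveM x1D x1D).
have c0D :=
  is_deriveD (is_deriveB (is_deriveD (is_deriveB bbD bxD) xxD) b1D) x2D.
apply: (is_derive_eq c0D).
by rewrite /dc0 /GRing.scale /=; field.
Qed.

Lemma is_derive_laxA00 z :
  is_derive t v (fun s => (laxA s ord0 ord0).[z]) (da1 * z + da0).
Proof.
under eq_fun do rewrite laxA00.
have D := is_deriveD (is_deriveM a1D (is_derive_cst z t v)) a0D.
by apply: (is_derive_eq D); rewrite /GRing.scale /=; ring.
Qed.

Lemma is_derive_laxA01 z :
  is_derive t v (fun s => (laxA s ord0 ord_max).[z])
    (db2 * z ^+ 2 + db1 * z + db0).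
Proof.
under eq_fun do rewrite laxA01.
have D := is_deriveD (is_deriveD (is_deriveD (is_derive_cst (z ^+ 3) t v)
  (is_deriveM b2D (is_derive_cst (z ^+ 2) t v)))
  (is_deriveM b1D (is_derive_cst z t v))) b0D.
by apply: (is_derive_eq D); rewrite /GRing.scale /=; ring.
Qed.

Lemma is_derive_laxA10 z :
  is_derive t v (fun s => (laxA s ord_max ord0).[z]) (dc1 * z + dc0).
Proof.
under eq_fun do rewrite laxA10.
have c1D := is_deriveD (is_deriveN b2D) x1D.
have D := is_deriveD (is_deriveD (is_derive_cst (z ^+ 2) t v)
  (is_deriveM c1D (is_derive_cst z t v))) is_derive_laxc0.
by apply: (is_derive_eq D); rewrite /dc1 /GRing.scale /=; ring.
Qed.

(** The function is [p0], that is, minus the determinant of [A] at [z = 0]. Its derivative is put in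
    the form that [isomonodromy_equations] shows to be zero. *)
Lemma is_derive_det_laxA0 :
  is_derive t v (fun s => a0 s ^+ 2 + b0 s * laxc0 s)
    (2 * a0 t * da0 + db0 * laxc0 t + b0 t * dc0).
Proof.
have D := is_deriveD (is_deriveM a0D a0D) (is_deriveM b0D is_derive_laxc0).
by apply: (is_derive_eq D); rewrite /GRing.scale /=; ring.
Qed.

(* The (2,2) entry of the zero-curvature equation is minus the (1,1) entry. *)
Lemma lax_zero_curvature_entries (B : 'M[{poly F}]_2) :
    \tr B = 0 -> (forall j k, (size (B j k) <= 3)%N) ->
    (forall z, \matrix_(j, k) 'D_v (fun s => (laxA s j k).[z]) t =
      map_mx (fun p : {poly F} => p.[z])
        ('X *: map_mx (fun p : {poly F} => p^`()) B
         + (laxA t *m B - B *m laxA t))) ->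
  let al n := (B ord0 ord0)`_n in let be n := (B ord0 ord_max)`_n in
  let ga n := (B ord_max ord0)`_n in
  let quad (f : nat -> F) z := f 0%N + f 1%N * z + f 2 * z ^+ 2 in
  let dquad (f : nat -> F) z := f 1%N + f 2 * z *+ 2 in
  let p z := a1 t * z + a0 t in
  let q z := z ^+ 3 + b2 t * z ^+ 2 + b1 t * z + b0 t in
  let r z := z ^+ 2 + laxc1 t * z + laxc0 t in
  [/\ forall z, da1 * z + da0
        = z * dquad al z + (q z * quad ga z - quad be z * r z),
      forall z, db2 * z ^+ 2 + db1 * z + db0
        = z * dquad be z + 2 * (p z * quad be z - q z * quad al z) &
      forall z, dc1 * z + dc0
        = z * dquad ga z + 2 * (r z * quad al z - p z * quad ga z)].
Proof.
move=> trB sB zc al be ga quad dquad p q r.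
have B11 : B ord_max ord_max = - B ord0 ord0.
  apply/eqP; rewrite -addr_eq0 addrC; apply/eqP; rewrite -trB /mxtrace.
  by rewrite big_ord_recl big_ord1; congr (_ + B _ _); apply: val_inj.
have entry j k z : 'D_v (fun s => (laxA s j k).[z]) t =
    z * (B j k)^`().[z] + (((laxA t j ord0).[z] * (B ord0 k).[z]
      + (laxA t j ord_max).[z] * (B ord_max k).[z])
      - ((B j ord0).[z] * (laxA t ord0 k).[z]
      + (B j ord_max).[z] * (laxA t ord_max k).[z])).
  by rewrite -horner_curvature_entry -zc mxE.
have ev j k z : (B j k).[z] = quad (fun n => (B j k)`_n) z.
  exact: horner_size3.
have dev j k z : (B j k)^`().[z] = dquad (fun n => (B j k)`_n) z.
  exact: horner_deriv_size3.
split=> z.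
- have := entry ord0 ord0 z; have D := is_derive_laxA00 z.
  rewrite (@derive_val _ _ _ _ _ _ _ D) => ->.
  by rewrite !dev !ev laxA00 laxA01 laxA10 -/al -/be -/ga -/(q z) -/(r z); ring.
- have := entry ord0 ord_max z; have D := is_derive_laxA01 z.
  rewrite (@derive_val _ _ _ _ _ _ _ D) => ->.
  rewrite B11 hornerN !dev !ev laxA00 laxA01 laxA11 -/al -/be -/ga.
  by rewrite -/(q z) -/(p z); ring.
- have := entry ord_max ord0 z; have D := is_derive_laxA10 z.
  rewrite (@derive_val _ _ _ _ _ _ _ D) => ->.
  rewrite B11 hornerN !dev !ev laxA00 laxA10 laxA11 -/al -/be -/ga.
  by rewrite -/(r z) -/(p z); ring.
Qed.
End LaxMatrix.

(** * From the two coordinate directions to total differentials *)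

Lemma total_d_basis (F : fieldType) (P Q k d1 d2 x y : F) :
  d1 = P * (1 / k) + Q * 0 -> d2 = P * (0 / k) + Q * 1 ->
  d1 * x + d2 * y = P * (x / k) + Q * y.
Proof.
move=> -> ->.
by rewrite mul0r !mulr0 add0r addr0 mulr1 mul1r mulrAC mulrA.
Qed.

Theorem mainTheorem5 (R : realType) (U : set (CC R * CC R))
    (a0 a1 b0 b1 b2 : CC R * CC R -> CC R) :
  domain U ->
  analytic_on U a0 -> analytic_on U a1 ->
  analytic_on U b0 -> analytic_on U b1 -> analytic_on U b2 ->
  let c0 : CC R * CC R -> CC R := fun t =>
    b2 t ^+ 2 - b2 t * t.1 + 1 / 4 * t.1 ^+ 2 - b1 t + t.2 in
  let c1 : CC R * CC R -> CC R := fun t => - b2 t + t.1 in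
  let A : CC R * CC R -> 'M[{poly CC R}]_2 := fun t =>
      'X ^+ 3 *: map_mx polyC (mx22 0 1 0 0)
    + 'X ^+ 2 *: map_mx polyC (mx22 0 (b2 t) 1 0)
    + 'X *: map_mx polyC (mx22 (a1 t) (b1 t) (c1 t) (- a1 t))
    + map_mx polyC (mx22 (a0 t) (b0 t) (c0 t) (- a0 t)) in
  (forall i : 'I_2, exists B : CC R * CC R -> 'M[{poly CC R}]_2,
     (forall t, U t -> \tr (B t) = 0) /\
     (forall t, U t -> forall j k : 'I_2, (size (B t j k) <= 3)%N) /\
     zero_curvature U i A B) ->
  let p0 : CC R * CC R -> CC R := fun t => a0 t ^+ 2 + b0 t * c0 t in
  forall t dt : CC R * CC R, U t ->
  let t1 := t.1 in let t2 := t.2 in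
  let dt1 := dt.1 in let dt2 := dt.2 in
  [/\ total_d a0 t dt =
        (16 * b2 t ^+ 4 - 16 * b2 t ^+ 3 * t1 + 4 * b2 t * t1 ^+ 3 - t1 ^+ 4
         - 48 * b1 t * b2 t ^+ 2 + 32 * b1 t * b2 t * t1 - 4 * b1 t * t1 ^+ 2
         + 32 * b2 t ^+ 2 * t2 - 16 * b2 t * t1 * t2
         - 16 * b0 t * b2 t + 8 * b0 t * t1 + 32 * b1 t ^+ 2
         - 48 * b1 t * t2 + 16 * t2 ^+ 2) * (dt1 / 48)
        + (3 * b2 t ^+ 2 * t1 - 2 * b2 t ^+ 3 - 3 * b2 t * t1 ^+ 2 / 2
           + t1 ^+ 3 / 4 + 2 * b1 t * b2 t - b1 t * t1 - 2 * b2 t * t2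
           + t1 * t2 + b0 t) * dt2,
      total_d a1 t dt =
        (- (16 * b2 t ^+ 3) + 20 * b2 t ^+ 2 * t1 - 4 * b2 t * t1 ^+ 2
         - t1 ^+ 3 + 16 * b1 t * b2 t - 16 * b1 t * t1 - 16 * b2 t * t2
         + 12 * t1 * t2 + 8 * b0 t) * (dt1 / 24)
        + (b2 t ^+ 2 - 2 * b2 t * t1 + 3 / 4 * t1 ^+ 2 + 2 * b1 t - t2) * dt2,
      total_d b0 t dt =
        (a0 t * t1 ^+ 2 - 4 * a0 t * b2 t ^+ 2 + 8 * a0 t * b1 t
         - 4 * a0 t * t2 - 4 * a1 t * b0 t) * (dt1 / 6)
        + (4 * b2 t - 2 * t1) * a0 t * dt2,
      total_d b1 t dt =
        (- (4 * a1 t * b2 t ^+ 2) + a1 t * t1 ^+ 2 + 4 * a0 t * b2 t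
         - 2 * a0 t * t1 + 4 * a1 t * b1 t - 4 * a1 t * t2
         + 2 * b2 t - t1) * (dt1 / 6)
        + (4 * a1 t * b2 t - 2 * a1 t * t1 + 2 * a0 t + 1) * dt2 &
      total_d b2 t dt =
        (- (a1 t * t1) + 2 * a0 t + 2) * (dt1 / 3) + 2 * a1 t * dt2]
  /\ total_d p0 t dt = 0.
Proof.
move=> _ a0U a1U b0U b1U b2U c0 c1 A zcA p0 t dt tU t1 t2 dt1 dt2.
(* In direction [basis i] the pair [(e1, e2)] is [basis i] itself. With [x1 = fst] and [x2 = snd],
   [laxA] and the function in [is_derive_det_laxA0] unfold to [A] and [p0]. *)
have equations i :=
  let D g (gU : analytic_on U g) :=
    analytic_is_derive i (gU t tU) in
  let x1D := is_derive_fst t (Defs.basis i) in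
  let x2D := is_derive_snd t (Defs.basis i) in
  conj (is_derive_det_laxA0 x1D x2D (D _ a0U) (D _ b0U) (D _ b1U) (D _ b2U))
  (let: ex_intro B (conj trB (conj sB zcB)) := zcA i in
  let: And3 eq11 eq12 eq21 := lax_zero_curvature_entries x1D x2D
    (D _ a0U) (D _ a1U) (D _ b0U) (D _ b1U) (D _ b2U)
    (trB t tU) (sB t tU) (zcB t tU) in
  isomonodromy_equations eq11 eq12 eq21).
have [p0D1 [[a0D1 a1D1 b0D1 b1D1 b2D1] p0E1]] := equations ord0.
have [p0D2 [[a0D2 a1D2 b0D2 b1D2 b2D2] p0E2]] := equations ord_max.
have {}p0E1 := etrans (@derive_val _ _ _ _ _ _ _ p0D1) p0E1.
have {}p0E2 := etrans (@derive_val _ _ _ _ _ _ _ p0D2) p0E2.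
split.
  (* The two partial derivatives are the values of the asserted 1-form at [(1, 0)] and [(0, 1)];
     linearity in [dt] gives the rest. *)
  split; exact: total_d_basis.
have -> : total_d p0 t dt = 0 * dt.1 + 0 * dt.2.
  by rewrite -{1}p0E1 -p0E2.
by rewrite !mul0r addr0.
Qed.
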